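(* If $h$ is a continuous function on the upper half-plane $\mathcal{H}$ that is invariant under two elliptic matrices in $\mathrm{SL}_2(\mathbb{R})$ of infinite order whose fixed points in $\mathcal{H}$ are distinct, then $h$ is constant.
   Context: $\mathrm{SL}_2(\mathbb{R})$ acts on $\mathcal{H}$ by Möbius transformations; $h$ is invariant under $M$ if $h(Mz)=h(z)$ for all $z\in\mathcal{H}$. An elliptic matrix ($|\mathrm{tr} M|<2$) has a unique fixed point in $\mathcal{H}$. *)

(* Defs.v *)
From HB Require Import structures.
From mathcomp Require Import all_boot all_order all_algebra.
From mathcomp Require Import all_classical all_reals all_analysis.
From mathcomp Require Import complex.

Set Implicit Arguments.
Unset Strict Implicit.
Unset Printing Implicit Defensive.

Import Order.TTheory GRing.Theory Num.Theory.
Import numFieldNormedType.Exports.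

Local Open Scope classical_set_scope.
Local Open Scope ring_scope.
Local Open Scope complex_scope.

(* R[i] as such carries no topology; it inherits that of its norm, i.e. of its *)
(* numFieldType structure.                                                     *)
HB.instance Definition _ (R : realType) :=
  NormedModule.copy R[i] (R[i] : numFieldType)^o.

Definition upper_half_plane (R : realType) : set R[i] :=
  [set z | 0 < complex.Im z].
Arguments upper_half_plane : clear implicits.

(* The matrix [a b; c d] sends z to (a z + b) / (c z + d).  The denominator is *)
(* nonzero for z in the upper half-plane when the matrix is invertible.        *)
Definition mobius (R : realType) (M : 'M[R]_2) (z : R[i]) : R[i] :=
  ((M 0 0)%:C * z + (M 0 1)%:C) / ((M 1 0)%:C * z + (M 1 1)%:C).

Definition SL2 (R : realType) : set 'M[R]_2 := [set M | \det M = 1].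
Arguments SL2 : clear implicits.

Definition elliptic (R : realType) (M : 'M[R]_2) : Prop := `|\tr M| < 2.

Definition infinite_order (R : realType) (M : 'M[R]_2) : Prop :=
  forall n : nat, (0 < n)%N -> M ^+ n <> 1.

Definition invariant_under (R : realType) (T : Type) (M : 'M[R]_2)
    (h : R[i] -> T) : Prop :=
  forall z, upper_half_plane R z -> h (mobius M z) = h z.

Definition fixed_point (R : realType) (M : 'M[R]_2) (z : R[i]) : Prop :=
  upper_half_plane R z /\ mobius M z = z.

(* Main.v *)
Require Import Defs.
From mathcomp Require Import all_boot all_order all_algebra.
From mathcomp Require Import all_classical all_reals all_analysis.
From mathcomp Require Import complex.
From mathcomp Require Import ring lra.
Import Order.TTheory GRing.Theory Num.Theory.
Import numFieldNormedType.Exports.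
Local Open Scope classical_set_scope.
Local Open Scope ring_scope.
Local Open Scope complex_scope.

(* The Cayley transform centred at the fixed point of M conjugates M to a
   rotation of the disc, of infinite order.  The angles of the rotations that
   preserve h form a closed subgroup of the reals which contains 2 pi and is not
   cyclic, hence everything: h is constant on every hyperbolic circle about
   either fixed point.  Each circle about the second fixed point meets a whole
   range of circles about the first one.  The length of this range, measured by
   cosh of the radius, is bounded below, so finitely many steps join any circle
   about the first fixed point to that point. *)

(** * Additive subgroups of the real line *)

(** The two cases are whether the positive elements of [T] have a positive lower bound. If not, the
    multiples of a small positive element come close to every real. *)
Lemma real_subgroup_cyclic_or_dense (R : realType) (T : set R) (p : R) :
  T p -> 0 < p -> (forall x y, T x -> T y -> T (x - y)) ->
  (exists t, 0 < t /\ forall x, T x -> exists n : int, x = n%:~R * t) \/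
  (forall x e, 0 < e -> exists y, T y /\ `|x - y| < e).
Proof.
move=> Tp p_gt0 TB.
have T0 : T 0 by rewrite -(subrr p); exact: TB.
have TM (n : int) t : T t -> T (n%:~R * t).
  move=> Tt; elim: n => [|n IH|n IH]; first by rewrite mul0r.
    suff -> : n.+1%:~R * t = n%:~R * t - (0 - t) by apply: (TB) => //; exact: TB.
    by rewrite intS rmorphD /=; ring.
  suff -> : (- n.+1%:Z)%:~R * t = (- n%:Z)%:~R * t - t by apply: (TB).
  by rewrite intS opprD rmorphD /=; ring.
have modT (t x : R) : 0 < t -> 0 <= x - (Num.floor (x / t))%:~R * t < t.
  move=> t_gt0; have /andP[lb ub] := floor_itv (x / t).
  rewrite subr_ge0 -ler_pdivlMr// lb /= ltrBlDl.
  by move: ub; rewrite ltr_pdivrMr// rmorphD /= mulrDl mul1r.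
have [[e [e_gt0 Te]]|small] :=
  pselect (exists e, 0 < e /\ forall t, T t -> 0 < t -> e <= t).
  left; pose S := [set t | T t /\ 0 < t].
  have S_inf : has_inf S by split; [exists p | exists e => t []; exact: Te].
  (* This [t] is less than [e] above the infimum. A nonzero remainder [r] modulo [t] is at least the
     infimum, so [t - r] would be a positive element smaller than [e]. *)
  have [t [Tt t_gt0] t_lt] := inf_adherent e_gt0 S_inf.
  exists t; split=> // x Tx; exists (Num.floor (x / t)).
  have /andP[r_ge0 r_lt] := modT t x t_gt0.
  set r := x - _ in r_ge0 r_lt.
  have Tr : T r by apply: (TB) => //; exact: TM.
  have [r_gt0|r_le0] := ltP 0 r; last by rewrite /r in r_ge0 r_le0; lra.
  have inf_r : inf S <= r by apply: ge_inf => //; case: S_inf.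
  have : e <= t - r by apply: Te; [exact: TB | rewrite subr_gt0].
  by lra.
right=> x e e_gt0.
have [t [Tt [t_gt0 t_lt]]] : exists t, T t /\ 0 < t /\ t < e.
  apply: contrapT => none; apply: (small); exists e; split=> // t Tt t_gt0.
  by rewrite leNgt; apply/negP => t_lt; apply: none; exists t.
have /andP[r_ge0 r_lt] := modT t x t_gt0.
exists ((Num.floor (x / t))%:~R * t); split; first exact: TM.
by rewrite ger0_norm//; exact: lt_trans t_lt.
Qed.

(** * Two families of hyperbolic circles *)

(** The expression equals (a^2 + b^2 + 1)^2 - 4 b^2, which is 4 b^2 sinh^2 of the hyperbolic
    distance from i to a + b i, so it is positive when the two centres differ. *)
Lemma half_plane_level_denom_gt0 (R : realType) (a b : R) :
  0 < b -> a != 0 \/ b != 1 ->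
  0 < 4 * a ^+ 2 + (a ^+ 2 + b ^+ 2 - 1) ^+ 2.
Proof.
move=> b_gt0 ab; set k := a ^+ 2 + b ^+ 2 - 1.
have k2 := sqr_ge0 k; have a2 := sqr_ge0 a.
rewrite lt_neqAle; apply/andP; split; last by lra.
apply/eqP => N0.
have a0 : a ^+ 2 = 0 by lra.
have /eqP : k ^+ 2 = 0 by lra.
rewrite sqrf_eq0 /k a0 => /eqP k0.
case: ab; first by rewrite -sqrf_eq0 a0 eqxx.
have /eqP : (b - 1) * (b + 1) = 0 by lra.
by rewrite mulf_eq0 => /orP[/eqP|/eqP]; [move=> b1 /eqP; lra | lra].
Qed.

(* In the hyperboloid coordinates X = x / y and 1 / y = p + T, level p about [i]
   is the circle X^2 + T^2 = p^2 - 1, on which the level about a + b i is the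
   affine function 2 (1 + k / 2) p - 2 a X + k T; [m] prescribes its value. *)
Lemma half_plane_level_point (R : realType) (a b p m : R) :
  0 < b -> a != 0 \/ b != 1 -> 1 <= p ->
  let k := a ^+ 2 + b ^+ 2 - 1 in let N := 4 * a ^+ 2 + k ^+ 2 in
  N * m ^+ 2 <= p ^+ 2 - 1 ->
  exists x y, [/\ 0 < y, x ^+ 2 + (y - 1) ^+ 2 = 2 * (p - 1) * y &
   (x - a) ^+ 2 + (y - b) ^+ 2 = (2 * (1 + k / 2) * p + N * m - 2 * b) * y].
Proof.
move=> b_gt0 ab p_ge1 k N Nm.
have N_gt0 : 0 < N by exact: half_plane_level_denom_gt0.
(* The vector (X, T) is m (-2a, k) + n (-k, -2a), in an orthogonal basis whose vectors have squared
   length [N]. The first one is the gradient of -2 a X + k T, so [m] fixes that form at [N * m], and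
   [n] puts the point on the circle. *)
pose n := Num.sqrt ((p ^+ 2 - 1) / N - m ^+ 2).
have n2 : n ^+ 2 = (p ^+ 2 - 1) / N - m ^+ 2.
  by rewrite sqr_sqrtr// subr_ge0 ler_pdivlMr// mulrC.
pose X := - 2 * a * m - k * n; pose T := k * m - 2 * a * n.
have XT : X ^+ 2 + T ^+ 2 = p ^+ 2 - 1.
  have -> : X ^+ 2 + T ^+ 2 = N * (m ^+ 2 + n ^+ 2) by rewrite /X /T /N; ring.
  by rewrite n2; field; rewrite gt_eqF.
have V_gt0 : 0 < p + T.
  have X2 := sqr_ge0 X; rewrite ltNge; apply/negP => V_le0.
  by have : p ^+ 2 <= T ^+ 2 by [nra]; lra.
have V_neq0 : p + T != 0 by rewrite gt_eqF.
have X2 : X ^+ 2 = p ^+ 2 - 1 - T ^+ 2 by lra.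
exists (X / (p + T)), (p + T)^-1; split; first by rewrite invr_gt0.
  apply: (mulIf (expf_neq0 2 V_neq0)).
  transitivity (X ^+ 2 + (1 - (p + T)) ^+ 2); first by field.
  by rewrite X2; field.
apply: (mulIf (expf_neq0 2 V_neq0)).
transitivity (X ^+ 2 + 1 - 2 * a * X * (p + T) - 2 * b * (p + T)
   + (a ^+ 2 + b ^+ 2) * (p + T) ^+ 2); first by field.
have aX : 2 * a * X = k * T - N * m by rewrite /X /T /N; ring.
have ab2 : a ^+ 2 + b ^+ 2 = k + 1 by rewrite /k; ring.
by rewrite X2 aX ab2; field.
Qed.

(** The first centre is normalised to i. Equal distance to a centre is expressed by equal squared
    Euclidean distance over height, with denominators cleared. The proof is an induction on the
    number of steps of size [d] needed to descend to level 1. *)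
Lemma half_plane_two_levels_constant (R : realType) (T : Type)
    (h : R -> R -> T) (a b : R) :
  0 < b -> a != 0 \/ b != 1 ->
  (forall x y x' y' : R, 0 < y -> 0 < y' ->
    (x ^+ 2 + (y - 1) ^+ 2) * y' = (x' ^+ 2 + (y' - 1) ^+ 2) * y ->
    h x y = h x' y') ->
  (forall x y x' y' : R, 0 < y -> 0 < y' ->
    ((x - a) ^+ 2 + (y - b) ^+ 2) * y' = ((x' - a) ^+ 2 + (y' - b) ^+ 2) * y ->
    h x y = h x' y') ->
  forall x y : R, 0 < y -> h x y = h 0 1.
Proof.
move=> b_gt0 ab h1 h2.
pose k := a ^+ 2 + b ^+ 2 - 1; pose N := 4 * a ^+ 2 + k ^+ 2.
pose c := 1 + k / 2.
have c_gt0 : 0 < c.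
  have a2 := sqr_ge0 a; have b2 : 0 < b ^+ 2 by rewrite exprn_gt0.
  by rewrite /c /k; lra.
have N_gt0 : 0 < N by exact: half_plane_level_denom_gt0.
(* For the choice m = -2 c e / N made below, N m^2 = 4 c^2 e^2 / N is at most 2 e exactly when e <=
   [d] (for e > 0), and 2 e <= (p + e)^2 - 1 for every p >= 1. The bound does not depend on [p]. *)
pose d := N / (2 * c ^+ 2).
have d_gt0 : 0 < d by rewrite divr_gt0// mulr_gt0// exprn_gt0.
have Nd : 2 * c ^+ 2 * d = N by rewrite /d; field; rewrite gt_eqF.
(* An [h2]-circle joins the [h1]-circles at levels [p] and [p + e]. *)
have step (p e : R) : 1 <= p -> 0 <= e -> e <= d -> exists x y x' y',
    [/\ 0 < y, 0 < y', x ^+ 2 + (y - 1) ^+ 2 = 2 * (p - 1) * y,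
     x' ^+ 2 + (y' - 1) ^+ 2 = 2 * (p + e - 1) * y' & h x y = h x' y'].
  move=> p_ge1 e_ge0 e_le.
  (* With m = 0 at level [p] and m = -2 c e / N at level [p + e], the level about the second centre
     is 2 c p - 2 b in both cases. *)
  have [|x [y [y_gt0 l1 l2]]] := half_plane_level_point _ _ _ _ 0 b_gt0 ab p_ge1.
    by rewrite expr0n /= mulr0; nra.
  have pe_ge1 : 1 <= p + e by lra.
  have [|x' [y' [y'_gt0 l1' l2']]] :=
    half_plane_level_point _ _ _ _ (- (2 * c * e) / N) b_gt0 ab pe_ge1.
    rewrite -/k -/N; have -> : N * (- (2 * c * e) / N) ^+ 2 =
        2 * e * (2 * c ^+ 2 * e / N) by field; rewrite gt_eqF.
    have : 2 * c ^+ 2 * e / N <= 1.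
      by rewrite ler_pdivrMr// mul1r -Nd ler_wpM2l// mulr_ge0// sqr_ge0.
    by move=> ?; nra.
  exists x, y, x', y'; split=> //; apply: h2 => //.
  rewrite l2 l2' -/k -/N -/c; field; rewrite gt_eqF//.
have cover n (p x y : R) : 1 <= p -> p <= 1 + n%:R * d -> 0 < y ->
    x ^+ 2 + (y - 1) ^+ 2 = 2 * (p - 1) * y -> h x y = h 0 1.
  (* In the base case the level is 1 and the circle is the point i. *)
  elim: n p x y => [|n IH] p x y p_ge1 p_le y_gt0 l.
    apply: h1 => //; rewrite l; have -> : p = 1 by lra.
    by ring.
  have [p_le'|p_gt] := leP p (1 + n%:R * d); first exact: IH l.
  (* The maximum shortens the last step, so that the level never falls below 1. *)
  pose q := Num.max 1 (p - d).
  have q_ge1 : 1 <= q by rewrite /q le_max lexx.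
  have q_ged : p - d <= q by rewrite /q le_max lexx orbT.
  have nd_ge0 : 0 <= n%:R * d by rewrite mulr_ge0// ltW.
  have q_le : q <= 1 + n%:R * d.
    by rewrite /q ge_max; apply/andP; split; [|rewrite -natr1 in p_le]; lra.
  have [||x1 [y1 [x2 [y2 [y1_gt0 y2_gt0 l1 l2 h12]]]]] := step q (p - q) q_ge1.
  - by lra.
  - by lra.
  transitivity (h x2 y2); last by rewrite -h12; exact: IH l1.
  apply: h1 => //; rewrite l l2; have -> : q + (p - q) = p by ring.
  by ring.
(* This [p] is cosh of the hyperbolic distance from x + y i to i. *)
move=> x y y_gt0; pose p := 1 + (x ^+ 2 + (y - 1) ^+ 2) / (2 * y).
have p_ge1 : 1 <= p.
  by rewrite /p lerDl divr_ge0// ?addr_ge0 ?sqr_ge0 ?mulr_ge0 ?ltW.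
have p1d : 0 <= (p - 1) / d by apply: divr_ge0; [lra | exact: ltW].
have p_lt := archi_boundP p1d; set n := Num.bound _ in p_lt.
apply: (cover n p) => //; first by rewrite ltr_pdivrMr// in p_lt; lra.
by rewrite /p; field; rewrite gt_eqF.
Qed.

(** * Unit complex numbers and invariance under rotations *)

Definition cis (R : realType) (t : R) : R[i] := cos t +i* sin t.
Arguments cis {R} t.

Lemma cisD (R : realType) (s t : R) : cis (s + t) = cis s * cis t.
Proof.
by apply/eqP; rewrite eq_complex /= cosD sinD; apply/andP; split; apply/eqP; ring.
Qed.

Lemma cis0 (R : realType) : cis 0 = 1 :> R[i].
Proof. by rewrite /cis cos0 sin0. Qed.

Lemma cisX (R : realType) (t : R) n : cis (n%:R * t) = cis t ^+ n.
Proof.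
elim: n => [|n IH]; first by rewrite mul0r cis0 expr0.
by rewrite -natr1 mulrDl mul1r cisD IH exprSr.
Qed.

Lemma cis2pi (R : realType) : cis (pi *+ 2) = 1 :> R[i].
Proof. by rewrite /cis cos2pi sin2pi. Qed.

Lemma cis_neq0 (R : realType) (t : R) : cis t != 0.
Proof.
apply/eqP => c0; have := cisD _ t (- t).
by rewrite c0 mul0r subrr cis0 => /eqP; rewrite oner_eq0.
Qed.

Lemma cis_int_period (R : realType) (n : int) : cis (n%:~R * (pi *+ 2)) = 1 :> R[i].
Proof.
case: n => n; first by rewrite -pmulrn cisX cis2pi expr1n.
apply: (mulIf (cis_neq0 _ (n.+1%:R * (pi *+ 2)))).
by rewrite -cisD mul1r NegzE mulrNz mulNr addNr cis0 cisX cis2pi expr1n.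
Qed.

Lemma cis_surj (R : realType) (z : R[i]) : z * conjc z = 1 -> exists t, z = cis t.
Proof.
case: z => a b /eqP; rewrite eq_complex /= => /andP[/eqP ab _].
have a2 := sqr_ge0 a; have b2 := sqr_ge0 b.
have ab1 : a ^+ 2 + b ^+ 2 = 1 by lra.
have a_itv : -1 <= a <= 1 by apply/andP; split; nra.
have cosa : cos (acos a) = a by apply: acosK; rewrite inE.
have sina : sin (acos a) = `|b|.
  by rewrite sin_acos// -ab1 addrAC subrr add0r sqrtr_sqr.
have [b_ge0|b_lt0] := leP 0 b.
  by exists (acos a); rewrite /cis cosa sina ger0_norm.
exists (- acos a).
by rewrite /cis cosN sinN cosa sina ltr0_norm// opprK.
Qed.

Lemma continuous_real_complex (R : realType) :
  continuous (fun x : R => x%:C : R[i]).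
Proof.
move=> x; apply/cvgrPdist_lt => e e_gt0.
(* A positive element of [R[i]] is real, which reduces the estimate to one over [R]. *)
move: (e_gt0); rewrite ltcE /= => /andP[/eqP e_im e_re].
near=> y.
have : `|x - y| < complex.Re e by near: y; exact: (@cvgr_dist_lt _ _ _ _ _ id).
rewrite -rmorphB normc_def /= expr0n addr0 sqrtr_sqr => xy.
by rewrite ltcE /= e_im eqxx.
Unshelve. all: by end_near.
Qed.

Lemma continuous_cis (R : realType) : continuous (@cis R).
Proof.
move=> t.
have -> : @cis R = fun t => (cos t)%:C + 'i%C * (sin t)%:C.
  by apply/funext => s; rewrite [LHS]complexE.
apply: cvgD.
  apply: (@cvg_comp _ _ _ (@cos R) (fun x => x%:C)); last exact: continuous_real_complex.
  exact: continuous_cos.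
apply: cvgM; first exact: cvg_cst.
apply: (@cvg_comp _ _ _ (@sin R) (fun x => x%:C)); last exact: continuous_real_complex.
exact: continuous_sin.
Qed.

(** If the angles preserving [g] on all of [D] were multiples of some [s], then 2 pi = m s and t0 =
    n s would give m t0 = n (2 pi), against the infinite order of [cis t0]. So these angles are
    dense, and continuity in the angle yields the rest. *)
Lemma invariant_of_infinite_order_rotation (R : realType) (D : set R[i])
    (g : R[i] -> R[i]) (t0 : R) :
  (forall q t, D q -> D (q * cis t)) ->
  (forall q, D q -> continuous (fun t => g (q * cis t))) ->
  (forall n, (0 < n)%N -> cis t0 ^+ n != 1) ->
  (forall q, D q -> g (q * cis t0) = g q) ->
  forall q t, D q -> g (q * cis t) = g q.
Proof.
move=> D_rot g_cont t0_inf g_t0.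
pose T := [set t | forall q, D q -> g (q * cis t) = g q].
have T2pi : T (pi *+ 2) by move=> q _; rewrite cis2pi mulr1.
have TB x y : T x -> T y -> T (x - y).
  move=> Tx Ty q Dq; rewrite -(Ty (q * cis (x - y))); last exact: D_rot.
  by rewrite -mulrA -cisD subrK Tx.
have pi2_gt0 : 0 < pi *+ 2 :> R by rewrite mulrn_wgt0 ?pi_gt0.
have [[s [s_gt0 Ts]]|T_dense] := real_subgroup_cyclic_or_dense _ _ _ T2pi pi2_gt0 TB.
  have [n t0E] := Ts t0 g_t0; have [m piE] := Ts _ T2pi.
  have m_gt0 : 0 < m by rewrite -(ltr0z R) -(pmulr_lgt0 _ s_gt0) -piE.
  case: m m_gt0 piE => // m m_gt0 piE.
  have /eqP[] := t0_inf _ m_gt0.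
  rewrite -cisX -(cis_int_period _ n) piE t0E; congr cis.
  by rewrite -pmulrn; ring.
move=> q t Dq; apply/eqP; apply: contrapT => /negP g_neq.
have e_gt0 : 0 < `|g (q * cis t) - g q| by rewrite normr_gt0 subr_eq0.
have /cvgrPdist_lt/(_ _ e_gt0)/nbhs_ballP[d /= d_gt0 near_t] := g_cont q Dq t.
have [s [Ts ts]] := T_dense t d d_gt0.
have := near_t s ts; rewrite /= Ts//.
by rewrite ltxx.
Qed.

(** * Squared modulus and Cayley transform *)

(** Valued in [R], whereas the norm of [R[i]] takes its values in [R[i]]. *)
Definition normsq (R : realType) (z : R[i]) : R :=
  complex.Re z ^+ 2 + complex.Im z ^+ 2.
Arguments normsq {R} z.

Lemma normsqM (R : realType) (z w : R[i]) :
  normsq (z * w) = normsq z * normsq w.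
Proof. by case: z w => [a b] [c d]; rewrite /normsq /=; ring. Qed.

Lemma normsq_eq0 (R : realType) (z : R[i]) : (normsq z == 0) = (z == 0).
Proof.
by case: z => a b; rewrite eq_complex /normsq /= paddr_eq0 ?sqr_ge0// !sqrf_eq0.
Qed.

Lemma normsqV (R : realType) (z : R[i]) : normsq z^-1 = (normsq z)^-1.
Proof.
have [->|z0] := eqVneq z 0; first by rewrite invr0 /normsq /= expr0n addr0 invr0.
have nz : normsq z != 0 by rewrite normsq_eq0.
apply: (mulIf nz); rewrite -normsqM !mulVf// /normsq /=.
by rewrite expr1n expr0n addr0.
Qed.

Lemma mul_conjc_normsq (R : realType) (z : R[i]) : z * conjc z = (normsq z)%:C.
Proof.
case: z => a b; apply/eqP; rewrite eq_complex /normsq /=.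
by apply/andP; split; apply/eqP; ring.
Qed.

Lemma normsq_cis (R : realType) (t : R) : normsq (cis t) = 1.
Proof. by rewrite /normsq /= cos2Dsin2. Qed.

Lemma Im_div (R : realType) (z w : R[i]) :
  complex.Im (z / w) = complex.Im (z * conjc w) / normsq w.
Proof. by case: z w => [a b] [c d]; rewrite /normsq /=; ring. Qed.

Definition cayley (R : realType) (p z : R[i]) : R[i] := (z - p) / (z - conjc p).
Arguments cayley {R} p z.

Definition cayley_inv (R : realType) (p q : R[i]) : R[i] :=
  (p - conjc p * q) / (1 - q).
Arguments cayley_inv {R} p q.

Lemma upper_half_plane_neq_conj (R : realType) (p z : R[i]) :
  upper_half_plane R p -> upper_half_plane R z -> z - conjc p != 0.
Proof.
case: p z => [a b] [x y]; rewrite /upper_half_plane /= => b_gt0 y_gt0.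
have yb : y - - b != 0 by apply: lt0r_neq0; lra.
by rewrite eq_complex /= negb_and yb orbT.
Qed.

Lemma cayleyK (R : realType) (p z : R[i]) :
  upper_half_plane R p -> z - conjc p != 0 -> cayley_inv p (cayley p z) = z.
Proof.
move=> p_up zp; have pp := upper_half_plane_neq_conj _ _ _ p_up p_up.
rewrite /cayley_inv /cayley; field; apply/andP; split=> //.
by have -> : z - conjc p - (z - p) = p - conjc p by ring.
Qed.

Lemma cayley_invK (R : realType) (p q : R[i]) :
  upper_half_plane R p -> 1 - q != 0 -> cayley p (cayley_inv p q) = q.
Proof.
move=> p_up q1; have pp := upper_half_plane_neq_conj _ _ _ p_up p_up.
rewrite /cayley_inv /cayley; move: (conjc p) pp => p' pp.
field; apply/andP; split=> //.
by have -> : p - p' * q + - p' * (1 - q) = p - p' by ring.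
Qed.

Lemma disc_neq1 (R : realType) (q : R[i]) : normsq q < 1 -> 1 - q != 0.
Proof.
move=> q_lt; rewrite subr_eq0; apply: contraTneq q_lt => <-.
by rewrite /normsq /= expr1n expr0n addr0 ltxx.
Qed.

Lemma cayley_inv_upper_half_plane (R : realType) (p q : R[i]) :
  upper_half_plane R p -> normsq q < 1 -> upper_half_plane R (cayley_inv p q).
Proof.
move=> p_up q_lt; have q1 := disc_neq1 _ _ q_lt.
rewrite /upper_half_plane /= Im_div.
have n_gt0 : 0 < normsq (1 - q).
  by rewrite lt_neqAle eq_sym normsq_eq0 q1 addr_ge0 ?sqr_ge0.
rewrite divr_gt0//.
have -> : complex.Im ((p - conjc p * q) * conjc (1 - q)) = complex.Im p * (1 - normsq q).
  by case: p q {p_up q_lt q1 n_gt0} => [a b] [x y]; rewrite /normsq /=; ring.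
by rewrite mulr_gt0// subr_gt0.
Qed.

(** The denominator is the squared distance to the conjugate centre. For positive [b] and [y] the
    quotient is an increasing function of |z - p|^2 / y, so circles about p become circles about
    0. *)
Lemma normsq_cayley (R : realType) (a b x y : R) :
  normsq (cayley (a +i* b) (x +i* y)) =
  ((x - a) ^+ 2 + (y - b) ^+ 2) / ((x - a) ^+ 2 + (y - b) ^+ 2 + 4 * b * y).
Proof.
rewrite /cayley normsqM normsqV /normsq /=; congr (_ / _); ring.
Qed.

Lemma continuous_cayley_inv_rotation (R : realType) (p q : R[i]) :
  normsq q < 1 -> continuous (fun t => cayley_inv p (q * cis t)).
Proof.
move=> q_lt t.
have qc : (fun s => q * cis s) s @[s --> t] --> q * cis t.
  by apply: cvgM; [exact: cvg_cst | exact: continuous_cis].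
apply: cvgM; first by apply: cvgB; [exact: cvg_cst |
  apply: cvgM; [exact: cvg_cst | exact: qc]].
apply: cvgV; last by apply: cvgB; [exact: cvg_cst | exact: qc].
by apply: disc_neq1; rewrite normsqM normsq_cis mulr1.
Qed.

(** Turns continuity of [h] relative to the half-plane into plain continuity along a path that stays
    inside it. *)
Lemma continuous_within_comp (T U V : topologicalType) (A : set U)
    (f : T -> U) (g : U -> V) :
  (forall t, A (f t)) -> continuous f -> {within A, continuous g} ->
  continuous (g \o f).
Proof.
move=> Af f_cont /subspace_continuousP g_cont t.
apply: cvg_comp (g_cont (f t) (Af t)).
move=> P nP; have nPf : \forall s \near t, A (f s) -> P (f s) := f_cont t _ nP.
suff : \forall s \near t, P (f s) by [].
by apply: filterS nPf => s; apply; exact: Af.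
Qed.

(** * The automorphy factor at a fixed point *)

Lemma mulmx2E (R : realType) (M N : 'M[R]_2) i j :
  (M * N) i j = M i 0 * N 0 j + M i 1 * N 1 j.
Proof.
rewrite mxE !big_ord_recl big_ord0 addr0.
by rewrite (_ : lift ord0 ord0 = 1)//; exact: val_inj.
Qed.

Lemma detmx2E (R : realType) (M : 'M[R]_2) :
  \det M = M 0 0 * M 1 1 - M 0 1 * M 1 0.
Proof.
rewrite (expand_det_row _ 0) !big_ord_recl big_ord0 addr0 /cofactor !det_mx11 !mxE.
rewrite (_ : lift 0 0 = 1 :> 'I_2); last exact: val_inj.
rewrite (_ : lift 1 0 = 0 :> 'I_2); last exact: val_inj.
by rewrite /= expr0 expr1; ring.
Qed.

Definition automorphy (R : realType) (M : 'M[R]_2) (z : R[i]) : R[i] :=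
  (M 1 0)%:C * z + (M 1 1)%:C.
Arguments automorphy {R} M z.

Lemma automorphy_neq0 (R : realType) (M : 'M[R]_2) (z : R[i]) :
  SL2 R M -> upper_half_plane R z -> automorphy M z != 0.
Proof.
rewrite /SL2 /= detmx2E /upper_half_plane /automorphy /=.
case: z => x y /= dM y_gt0; rewrite eq_complex /=; apply/negP => /andP[/eqP r /eqP i].
have /eqP : M 1 0 * y = 0 by lra.
rewrite mulf_eq0 (gt_eqF y_gt0) orbF => /eqP c0.
have d0 : M 1 1 = 0 by rewrite c0 in r; lra.
by rewrite c0 d0 in dM; lra.
Qed.

Lemma fixed_point_eigen (R : realType) (M : 'M[R]_2) (p : R[i]) :
  SL2 R M -> fixed_point M p ->
  (M 0 0)%:C * p + (M 0 1)%:C = automorphy M p * p.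
Proof.
move=> dM [p_up Mp]; have l0 := automorphy_neq0 _ _ _ dM p_up.
transitivity (automorphy M p * mobius M p); last by rewrite Mp.
by rewrite /mobius -/(automorphy M p) [RHS]mulrC divfK.
Qed.

(** Since M is real, its eigenvalues for (p, 1) and for the conjugate vector are conjugate, and
    their product is the determinant 1. *)
Lemma automorphy_fixed_unit (R : realType) (M : 'M[R]_2) (p : R[i]) :
  SL2 R M -> fixed_point M p -> automorphy M p * conjc (automorphy M p) = 1.
Proof.
move=> dM Mp; have p_up := Mp.1; have eig := fixed_point_eigen _ _ _ dM Mp.
have pp := upper_half_plane_neq_conj _ _ _ p_up p_up.
have lE : conjc (automorphy M p) = automorphy M (conjc p).
  by rewrite /automorphy rmorphD rmorphM /= !oppr0.
have eig' : (M 0 0)%:C * conjc p + (M 0 1)%:C = automorphy M (conjc p) * conjc p.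
  by rewrite -lE -rmorphM -eig rmorphD rmorphM /= !oppr0.
apply: (mulIf pp); rewrite lE mul1r.
(* This is the determinant of M times the matrix with columns (p, 1) and (conjc p, 1). *)
transitivity (automorphy M (conjc p) * ((M 0 0)%:C * p + (M 0 1)%:C) -
   automorphy M p * ((M 0 0)%:C * conjc p + (M 0 1)%:C)).
  by rewrite eig eig'; ring.
transitivity (((M 0 0)%:C * (M 1 1)%:C - (M 0 1)%:C * (M 1 0)%:C) * (p - conjc p)).
  by rewrite /automorphy; ring.
rewrite -!rmorphM -rmorphB /= -detmx2E dM; exact: mul1r.
Qed.

(* The vector (p, 1) is an eigenvector of M with eigenvalue [automorphy M p]. *)
Lemma fixed_point_eigenX (R : realType) (M : 'M[R]_2) (p : R[i]) n :
  SL2 R M -> fixed_point M p ->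
  ((M ^+ n) 0 0)%:C * p + ((M ^+ n) 0 1)%:C = automorphy M p ^+ n * p /\
  ((M ^+ n) 1 0)%:C * p + ((M ^+ n) 1 1)%:C = automorphy M p ^+ n.
Proof.
move=> dM Mp; have eig := fixed_point_eigen _ _ _ dM Mp.
elim: n => [|n [IH0 IH1]].
  rewrite !expr0 !mxE /=; have -> : (1 : R)%:C = 1 by [].
  by rewrite !mul1r mul0r addr0 add0r.
have step i : ((M ^+ n.+1) i 0)%:C * p + ((M ^+ n.+1) i 1)%:C =
    (((M ^+ n) i 0)%:C * p + ((M ^+ n) i 1)%:C) * automorphy M p.
  rewrite exprSr !mulmx2E !rmorphD !rmorphM /=.
  transitivity (((M ^+ n) i 0)%:C * ((M 0 0)%:C * p + (M 0 1)%:C) +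
    ((M ^+ n) i 1)%:C * automorphy M p); first by rewrite /automorphy; ring.
  by rewrite eig; ring.
by rewrite !step IH0 IH1 -!exprSr; split=> //; rewrite exprSr; ring.
Qed.

(** If the n-th power of the eigenvalue is 1, then M^n fixes (p, 1). The real and imaginary parts of
    this vector span the plane because Im p > 0, so the real matrix M^n is the identity. *)
Lemma automorphy_infinite_order (R : realType) (M : 'M[R]_2) (p : R[i]) n :
  SL2 R M -> fixed_point M p -> infinite_order M -> (0 < n)%N ->
  automorphy M p ^+ n != 1.
Proof.
move=> dM Mp M_inf n_gt0; apply/eqP => l1; apply: (M_inf _ n_gt0).
have [] := fixed_point_eigenX _ _ _ n dM Mp; have p_up := Mp.1; rewrite l1 mul1r.
case: p p_up {Mp l1} => x y; rewrite /upper_half_plane /= => y_gt0.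
set P := M ^+ n => /eqP; rewrite eq_complex /= => /andP[/eqP r0 /eqP i0].
move=> /eqP; rewrite eq_complex /= => /andP[/eqP r1 /eqP i1].
have y0 : y != 0 by rewrite gt_eqF.
have P00 : P 0 0 = 1 by apply: (mulIf y0); lra.
have P10 : P 1 0 = 0 by apply: (mulIf y0); lra.
have P01 : P 0 1 = 0 by rewrite P00 in r0; lra.
have P11 : P 1 1 = 1 by rewrite P10 in r1; lra.
have o2 (i : 'I_2) : i = 0 \/ i = 1.
  by case: i => [[|[|//]] ?]; [left|right]; exact: val_inj.
by apply/matrixP => i j; rewrite !mxE; case: (o2 i) (o2 j) => -> [] ->.
Qed.

(** For w fixed by M, Mz - w is z - w divided by the automorphy factors at z and w. Taking w = p and
    w = conjc p, the quotient gains the ratio of the conjugate eigenvalue to the eigenvalue, which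
    is the square of the former by unimodularity. *)
Lemma cayley_mobius (R : realType) (M : 'M[R]_2) (p z : R[i]) :
  SL2 R M -> fixed_point M p -> upper_half_plane R z ->
  mobius M z - conjc p != 0 /\
  cayley p (mobius M z) = cayley p z * conjc (automorphy M p) ^+ 2.
Proof.
move=> dM Mp z_up; have p_up := Mp.1.
have l1 := automorphy_fixed_unit _ _ _ dM Mp.
have l0 := automorphy_neq0 _ _ _ dM p_up.
have m0 := automorphy_neq0 _ _ _ dM z_up.
have zp := upper_half_plane_neq_conj _ _ _ p_up z_up.
have eig := fixed_point_eigen _ _ _ dM Mp.
have lE : conjc (automorphy M p) = automorphy M (conjc p).
  by rewrite /automorphy rmorphD rmorphM /= !oppr0.
have eig' : (M 0 0)%:C * conjc p + (M 0 1)%:C = automorphy M (conjc p) * conjc p.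
  by rewrite -lE -rmorphM -eig rmorphD rmorphM /= !oppr0.
have lc0 : automorphy M (conjc p) != 0 by rewrite -lE conjc_eq0.
have diff w : automorphy M w != 0 ->
    (M 0 0)%:C * w + (M 0 1)%:C = automorphy M w * w ->
    mobius M z - w = (z - w) / (automorphy M z * automorphy M w).
  move=> w0 eigw; rewrite /mobius -/(automorphy M z).
  have wE : w = ((M 0 0)%:C * w + (M 0 1)%:C) / automorphy M w.
    by rewrite eigw mulrC mulKf.
  rewrite {1}wE; transitivity ((((M 0 0)%:C * z + (M 0 1)%:C) * automorphy M w -
     ((M 0 0)%:C * w + (M 0 1)%:C) * automorphy M z) /
     (automorphy M z * automorphy M w)); first by field; apply/andP.
  congr (_ / _).
  transitivity (((M 0 0)%:C * (M 1 1)%:C - (M 0 1)%:C * (M 1 0)%:C) * (z - w)).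
    by rewrite /automorphy; ring.
  rewrite -!rmorphM -rmorphB /= -detmx2E dM; exact: mul1r.
split; first by rewrite diff// mulf_neq0// invr_neq0// mulf_neq0.
transitivity ((z - p) / (z - conjc p) *
  (automorphy M (conjc p) / automorphy M p)).
  by rewrite /cayley !diff//; field; apply/and4P.
congr (_ * _); apply: (mulIf l0); rewrite divfK// lE -[LHS]mulr1 -l1 lE.
by ring.
Qed.

(** * Constancy on hyperbolic circles, and the conclusion *)

(** Read in the disc through [cayley_inv], [h] is invariant under the rotation [zeta], hence under
    all rotations; the level condition says that the two Cayley images have equal modulus. *)
Lemma invariant_constant_on_circles (R : realType) (h : R[i] -> R[i])
    (M : 'M[R]_2) (p : R[i]) :
  {within upper_half_plane R, continuous h} -> SL2 R M -> infinite_order M ->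
  fixed_point M p -> invariant_under M h ->
  forall x y x' y' : R, 0 < y -> 0 < y' ->
    ((x - complex.Re p) ^+ 2 + (y - complex.Im p) ^+ 2) * y' =
    ((x' - complex.Re p) ^+ 2 + (y' - complex.Im p) ^+ 2) * y ->
    h (x +i* y) = h (x' +i* y').
Proof.
move=> h_cont dM M_inf Mp h_inv x y x' y' y_gt0 y'_gt0 level.
have p_up := Mp.1.
have b_gt0 : 0 < complex.Im p by [].
pose zeta := conjc (automorphy M p) ^+ 2.
have l1 := automorphy_fixed_unit _ _ _ dM Mp.
have zeta_unit : zeta * conjc zeta = 1.
  by rewrite /zeta rmorphXn /= conjcK -exprMn mulrC l1 expr1n.
have [t0 t0E] := cis_surj _ _ zeta_unit.
pose D := [set q : R[i] | normsq q < 1].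
pose g q := h (cayley_inv p q).
have D_rot q t : D q -> D (q * cis t).
  by rewrite /D /= normsqM normsq_cis mulr1.
have g_cont q : D q -> continuous (fun t => g (q * cis t)).
  move=> Dq; have f_cont := continuous_cayley_inv_rotation R p q Dq.
  apply: (continuous_within_comp _ _ _ _ _ _ _ f_cont h_cont) => t.
  by apply: cayley_inv_upper_half_plane => //; exact: D_rot.
have t0_inf n : (0 < n)%N -> cis t0 ^+ n != 1.
  (* As [zeta] is a square, its n-th power is governed by the power 2 n of the eigenvalue. *)
  move=> n_gt0; rewrite -t0E /zeta -exprM -rmorphXn /=; apply/eqP => /(congr1 conjc).
  rewrite conjcK conjc1; apply/eqP.
  by apply: automorphy_infinite_order => //; rewrite muln_gt0.
have g_t0 q : D q -> g (q * cis t0) = g q.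
  move=> Dq; have z_up := cayley_inv_upper_half_plane _ _ _ p_up Dq.
  have [Mz_neq cMz] := cayley_mobius _ _ _ _ dM Mp z_up.
  rewrite cayley_invK// in cMz; last exact: disc_neq1.
  by rewrite /g -t0E /zeta -cMz cayleyK// h_inv.
have g_rot := invariant_of_infinite_order_rotation _ _ _ _ D_rot g_cont t0_inf g_t0.
pose z := x +i* y; pose w := x' +i* y'.
have z_up : upper_half_plane R z by [].
have w_up : upper_half_plane R w by [].
have zp := upper_half_plane_neq_conj _ _ _ p_up z_up.
have wp := upper_half_plane_neq_conj _ _ _ p_up w_up.
rewrite -/z -/w -(cayleyK _ _ _ p_up zp) -(cayleyK _ _ _ p_up wp) -/(g _) -/(g _).
have A_ge0 u v : 0 <= (u - complex.Re p) ^+ 2 + (v - complex.Im p) ^+ 2.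
  by rewrite addr_ge0 ?sqr_ge0.
have yb : 0 < complex.Im p * y by rewrite mulr_gt0.
have yb' : 0 < complex.Im p * y' by rewrite mulr_gt0.
have A := A_ge0 x y; have A' := A_ge0 x' y'.
have Ncay u v : normsq (cayley p (u +i* v)) =
    ((u - complex.Re p) ^+ 2 + (v - complex.Im p) ^+ 2) /
    ((u - complex.Re p) ^+ 2 + (v - complex.Im p) ^+ 2 + 4 * complex.Im p * v).
  by rewrite -normsq_cayley; case: (p).
have normE : normsq (cayley p w) = normsq (cayley p z).
  rewrite !Ncay; apply/eqP; rewrite eqr_div; try by apply: lt0r_neq0; lra.
  by apply/eqP; rewrite !mulrDr -!(mulrCA (4 * complex.Im p)) -level; ring.
have Dz : D (cayley p z).
  by rewrite /D /= Ncay ltr_pdivrMr; lra.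
(* At the centre no quotient of the images is available, but both images are then 0. *)
have [z0|z0] := eqVneq (cayley p z) 0.
  have /eqP : normsq (cayley p w) = 0 by rewrite normE; apply/eqP; rewrite normsq_eq0 z0.
  by rewrite normsq_eq0 z0 => /eqP ->.
have nz0 : normsq (cayley p z) != 0 by rewrite normsq_eq0.
have [t tE] : exists t, cayley p w / cayley p z = cis t.
  by apply: cis_surj; rewrite mul_conjc_normsq normsqM normsqV normE divff.
by rewrite -(divfK z0 (cayley p w)) mulrC tE g_rot.
Qed.

Theorem theorem3p11 (R : realType) (h : R[i] -> R[i])
    (h_cont : {within upper_half_plane R, continuous h})
    (M1 M2 : 'M[R]_2) (z1 z2 : R[i])
    (M1_SL2 : SL2 R M1) (M2_SL2 : SL2 R M2)
    (M1_ell : elliptic M1) (M2_ell : elliptic M2)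
    (M1_inf : infinite_order M1) (M2_inf : infinite_order M2)
    (M1_fix : fixed_point M1 z1) (M2_fix : fixed_point M2 z2)
    (z1_neq_z2 : z1 <> z2)
    (h_inv1 : invariant_under M1 h) (h_inv2 : invariant_under M2 h) :
  exists c : R[i], forall z, upper_half_plane R z -> h z = c.
Proof.
have h1 := invariant_constant_on_circles _ _ _ _ h_cont M1_SL2 M1_inf M1_fix h_inv1.
have h2 := invariant_constant_on_circles _ _ _ _ h_cont M2_SL2 M2_inf M2_fix h_inv2.
have : 0 < complex.Im z1 := M1_fix.1; have : 0 < complex.Im z2 := M2_fix.1.
case: z1 z2 z1_neq_z2 h1 h2 {M1_fix M2_fix} => a1 b1 [a2 b2] neq /= h1 h2 b2_gt0 b1_gt0.
have b1_neq0 : b1 != 0 by rewrite gt_eqF.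
(* The affine change of variable [z = a1 + b1 u] moves the first centre to [i]. *)
pose k x y := h ((a1 + b1 * x) +i* (b1 * y)).
have scale (u v : R) : 0 < v -> 0 < b1 * v by move=> ?; rewrite mulr_gt0.
have centre_neq : (a2 - a1) / b1 != 0 \/ b2 / b1 != 1.
  have [aE|aN] := eqVneq ((a2 - a1) / b1) 0; [right | by left].
  apply/eqP => bE; apply: neq; congr (_ +i* _); last by rewrite -[RHS](divfK b1_neq0) bE mul1r.
  by apply/esym/eqP; rewrite -subr_eq0 -[X in X == _](divfK b1_neq0) aE mul0r.
have k1 (x y x' y' : R) : 0 < y -> 0 < y' ->
    (x ^+ 2 + (y - 1) ^+ 2) * y' = (x' ^+ 2 + (y' - 1) ^+ 2) * y ->
    k x y = k x' y'.
  move=> y_gt0 y'_gt0 l; apply: h1; try exact: scale.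
  (* Scaling by [b1] contributes two factors from the squares and one from the height. *)
  by transitivity (b1 ^+ 3 * ((x ^+ 2 + (y - 1) ^+ 2) * y')); [ring | rewrite l; ring].
pose a := (a2 - a1) / b1; pose b := b2 / b1.
have aE : a2 = a1 + b1 * a by rewrite /a; field.
have bE : b2 = b1 * b by rewrite /b; field.
have k2 (x y x' y' : R) : 0 < y -> 0 < y' ->
    ((x - a) ^+ 2 + (y - b) ^+ 2) * y' = ((x' - a) ^+ 2 + (y' - b) ^+ 2) * y ->
    k x y = k x' y'.
  move=> y_gt0 y'_gt0 l; apply: h2; try exact: scale.
  rewrite aE bE; transitivity (b1 ^+ 3 * (((x - a) ^+ 2 + (y - b) ^+ 2) * y')).
    by ring.
  by rewrite l; ring.
have b_gt0 : 0 < b by rewrite divr_gt0.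
have k_const := half_plane_two_levels_constant _ _ _ _ _ b_gt0 centre_neq k1 k2.
(* The constant is the value of [h] at the first fixed point. *)
exists (k 0 1); case=> x y; rewrite /upper_half_plane /= => y_gt0.
rewrite -(k_const ((x - a1) / b1) (y / b1)) ?divr_gt0// /k.
by congr (h (_ +i* _)); field.
Qed.
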